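(* For every $A>0$ and $\lambda>0$ there exist a constant $K>0$ depending only on $\lambda$ and $A$, and a constant $C>0$ depending only on $A$, such that the following holds. Let $\mathcal{S}$ be a set of positive integers, and let $s$ be any positive integer dividing every element of $\mathcal{S}$. Let $g\in\mathscr{G}(A)$, let $x>1$ be real with $x\ge s^2$, let $B\ge \exp\{-\sqrt{\log x}\}$, and suppose that \[ \#\Big\{ q \text{ prime} : q\le \frac{x}{rs},\ qrs\in\mathcal{S}\Big\} \le B x\,\frac{g(r)}{\big(\log \frac{2x}{rs}\big)^{\lambda}}\qquad\text{for all integers } r \text{ with } 1\le r\le x/s . \] Then, for every positive integer $k$, \[ \#\{ n\in\mathcal{S} : n\le x,\ \omega(n/s)=k\} \le K\, B x\, \frac{(G(x)+C)^{k-1}}{(k-1)!\,(\log x)^{\lambda}}, \qquad\text{where } G(x)=\sum_{p\le x} g(p). \]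
   Context: $\omega(n)$ denotes the number of distinct prime factors of the positive integer $n$. The symbols $p$ and $q$ denote primes. For $A>0$, $\mathscr{G}(A)$ denotes the set of non-negative real-valued multiplicative functions $g$ on the positive integers satisfying $g(p^v)\le A/p^v$ for every prime $p$ and every positive integer $v$. The convention $0^0=1$ is used. *)

(* Defs.v *)
From HB Require Import structures.
From mathcomp Require Import all_boot all_order all_algebra finmap.
From mathcomp Require Import all_classical all_reals all_analysis.

Set Implicit Arguments.
Unset Strict Implicit.
Unset Printing Implicit Defensive.

Import Order.TTheory GRing.Theory Num.Theory.

Local Open Scope classical_set_scope.
Local Open Scope ring_scope.

Definition omega (n : nat) : nat := size (primes n).

(* Arithmetic functions are maps [nat -> R] whose value at 0 is irrelevant. *)
Definition arith_multiplicative (R : realType) (g : nat -> R) : Prop :=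
  g 1%N = 1 /\
  forall m n : nat, (0 < m)%N -> (0 < n)%N -> coprime m n ->
    g (m * n)%N = g m * g n.

Definition scrG (R : realType) (A : R) : set (nat -> R) :=
  [set g | [/\ arith_multiplicative g,
               forall n : nat, (0 < n)%N -> 0 <= g n &
               forall p v : nat, prime p -> (0 < v)%N ->
                 g (p ^ v)%N <= A / (p ^ v)%:R]].

(* [Num.truncn x] is the integer part of [x] when [0 <= x]. *)
Definition prime_sum (R : realType) (g : nat -> R) (x : R) : R :=
  \sum_(0 <= p < (Num.truncn x).+1 | prime p) g p.

(* [fset_set] sends an infinite set to the empty one; [ncard] is meant for
   bounded sets of integers only. *)
Definition ncard (X : set nat) : nat := #|` fset_set X|%fset.

(* Main.v *)
Require Import Defs.
From HB Require Import structures.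
From mathcomp Require Import all_boot all_order all_algebra finmap.
From mathcomp Require Import all_classical all_reals all_analysis.
From mathcomp Require Import zify ring lra.

Set Implicit Arguments.
Unset Strict Implicit.
Unset Printing Implicit Defensive.

Import Order.TTheory GRing.Theory Num.Theory.

Local Open Scope classical_set_scope.
Local Open Scope ring_scope.

(** Write n = s m with m = q r, where q is the largest prime factor of m, and
    count the n lying over each r. If q does not divide r, then omega r = k - 1
    and the hypothesis bounds the number of admissible q. If q divides r, then
    omega r = k and q is the largest prime factor of r, so that there is at most
    one n over r; the hypothesis applies as well. In both cases every prime p
    dividing r satisfies p r s <= x. This is [ncard_le_sum_fibres], and it
    reduces the theorem to bounding sums over r of
    g(r) / (log (2 x / (r s)))^lambda.

    For r <= x^(1/4) the logarithm is at least (log x) / 4, since s <= x^(1/2).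
    If omega r = k - 1, the sum of g(r) is at most W^(k-1) / (k-1)!, where W is
    G(x) + O(A). If omega r = k, this route would give one power of W too many,
    so the r are counted instead by Rankin's trick with the exponent 2: there
    are at most x^(1/2) c^k / k! of them, which is admissible because
    B x >= x exp (- sqrt (log x)) dominates x^(1/2) times any power of log x.

    For r > x^(1/4) let q now be the largest prime factor of r. Since
    q r s <= x, the logarithm is at least log q, and Rankin's trick with the
    exponent theta = 1 / (4 log q) brings in the factor
    x^(- theta / 4) = exp (- u / 16), with u = log x / log q. This outweighs any
    power of u, so log q can be traded for log x at the cost of a constant
    depending on lambda only ([decay_le]). The twist by r^theta changes the sum
    of g(p) over p < q by O(A) only, because the sum of log p / p over p <= q is
    O(log q); for this reason C depends on A alone. If omega r = k - 1, the sum
    over q of w(q) V(q)^(k-2) / (k-2)!, in which V(q) is a constant plus the sum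
    of w(p) over p < q, telescopes to V^(k-1) / (k-1)!, so no power is lost. If
    omega r = k, one keeps a further factor log q / log x out of the decay, and
    the sum over q of (1/q) (log q / log x) is bounded: the prime q costs a
    constant instead of a power of V. *)

(** * Sums split according to the largest prime factor *)

Lemma le_sum_term (R : numDomainType) (I : eqType) (s : seq I) (P : pred I)
    (F : I -> R) (i : I) :
  i \in s -> P i -> (forall j, j \in s -> P j -> 0 <= F j) ->
  F i <= \sum_(j <- s | P j) F j.
Proof.
move=> si Pi F_ge0; rewrite big_seq_cond (big_rem i) //= si Pi /= lerDl.
rewrite big_seq_cond; apply: sumr_ge0 => j /andP[_ /andP[sj Pj]]; exact: F_ge0.
Qed.

Lemma sum_delta_le (R : numDomainType) (I : eqType) (s : seq I) (P : pred I)
    (i : I) (c : R) :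
  uniq s -> 0 <= c -> \sum_(j <- s | P j) (if j == i then c else 0) <= c.
Proof.
move=> s_uniq c_ge0; rewrite -big_mkcondr big_const_seq iter_addr_0.
rewrite -[leRHS]mulr1n; apply: ler_wpMn2l => //.
apply: leq_trans (leq_b1 (i \in s)); rewrite -(count_uniq_mem _ s_uniq).
by apply: sub_count => j /= /andP[].
Qed.

Definition friable (z r : nat) : bool := all (fun p => p < z)%N (primes r).

Definition stratum (j z : nat) : pred nat :=
  fun r => (omega r == j) && friable z r.

(** The witnesses are the largest prime factor q of r, its exponent v, and the
    part of r prime to q. *)
Lemma split_largest_prime (j z r : nat) : (0 < r)%N -> stratum j.+1 z r ->
  exists q v r' : nat,
    [/\ prime q && (q < z)%N, (0 < v)%N, (0 < r')%N && coprime q r',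
        stratum j q r' & r = (q ^ v * r')%N].
Proof.
move=> r_gt0 /andP[/eqP r_om /allP r_fr].
have r_gt1 : (1 < r)%N.
  rewrite ltn_neqAle r_gt0 andbT; apply/eqP => r1.
  by move: r_om; rewrite -r1.
set q := max_pdiv r.
have q_pr : prime q by exact: max_pdiv_prime.
have q_in : q \in primes r by rewrite mem_primes q_pr r_gt0 max_pdiv_dvd.
exists q, (logn q r), (r`_(q^'))%N; split.
- by rewrite q_pr r_fr.
- by rewrite logn_gt0.
- rewrite part_gt0 /=; apply: (@pnat_coprime q); first exact: pnat_id.
  exact: part_pnat.
- rewrite /stratum /omega /friable primes_part; apply/andP; split.
    apply/eqP/succn_inj; rewrite -r_om /omega size_filter -add1n.
    rewrite -(count_predC (pred1 q) (primes r)).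
    by rewrite count_uniq_mem ?primes_uniq // q_in.
  apply/allP => p; rewrite mem_filter !inE => /andP[pq p_in].
  by rewrite ltn_neqAle pq max_pdiv_max.
- by rewrite -p_part partnC.
Qed.

(** Each r on the left is q ^ v * r' for exactly one triple on the right. The
    bound N is kept on all the variables, so the right-hand side may contain
    further terms; they are non-negative. *)
Lemma sum_by_largest_prime (R : realDomainType) (H : nat -> R) (N j z : nat) :
  (forall r, (0 < r)%N -> 0 <= H r) ->
  \sum_(1 <= r < N.+1 | stratum j.+1 z r) H r <=
  \sum_(0 <= q < z | prime q) \sum_(1 <= v < N.+1)
    \sum_(1 <= r < N.+1 | stratum j q r && coprime q r) H (q ^ v * r)%N.
Proof.
move=> H_ge0.
pose T q v r m : R := if r == (q ^ v * m)%N then H (q ^ v * m)%N else 0.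
have T_ge0 q v r m : prime q -> (0 < m)%N -> 0 <= T q v r m.
  move=> /prime_gt0 q_gt0 m_gt0; rewrite /T; case: ifP => // _.
  by apply: H_ge0; rewrite muln_gt0 expn_gt0 q_gt0.
(* H r occurs among the inner terms of the intermediate sum. *)
apply: (@le_trans _ _ (\sum_(1 <= r < N.+1 | stratum j.+1 z r)
  \sum_(0 <= q < z | prime q) \sum_(1 <= v < N.+1)
    \sum_(1 <= m < N.+1 | stratum j q m && coprime q m) T q v r m)).
  rewrite big_nat_cond [leRHS]big_nat_cond.
  apply: ler_sum => r /andP[/andP[r_gt0 r_le] r_str].
  have [q [v [m [/andP[q_pr qz] v_gt0 /andP[m_gt0 qm] m_str r_eq]]]] :=
    split_largest_prime r_gt0 r_str.
  have qv_gt0 : (0 < q ^ v)%N by rewrite expn_gt0 prime_gt0.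
  have m_le : (m <= r)%N by rewrite r_eq leq_pmull.
  have v_lt : (v < r.+1)%N.
    rewrite ltnS r_eq; apply: leq_trans (ltnW (ltn_expl v (prime_gt1 q_pr))) _.
    exact: leq_pmulr.
  have sum_ge0 q' v' : prime q' -> 0 <= \sum_(1 <= m' < N.+1 |
      stratum j q' m' && coprime q' m') T q' v' r m'.
    move=> q'_pr; rewrite big_nat_cond; apply: sumr_ge0 => m'.
    by move=> /andP[/andP[m'_gt0 _] _]; exact: T_ge0.
  have -> : H r = T q v r m by rewrite /T r_eq eqxx.
  apply: le_trans (le_sum_term (i := q) _ _ _); last 3 first.
  - by rewrite mem_index_iota.
  - exact: q_pr.
  - by move=> q' _ q'_pr; apply: sumr_ge0 => v' _; exact: sum_ge0.
  apply: le_trans (le_sum_term (i := v) _ _ _); last 3 first.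
  - by rewrite mem_index_iota v_gt0 (leq_trans v_lt).
  - by [].
  - by move=> v' _ _; exact: sum_ge0.
  apply: (le_sum_term (i := m)).
  - by rewrite mem_index_iota m_gt0 (leq_ltn_trans m_le).
  - by rewrite m_str.
  - by move=> m'; rewrite mem_index_iota => /andP[m'_gt0 _] _; exact: T_ge0.
rewrite exchange_big /=; apply: ler_sum => q q_pr.
rewrite exchange_big /=; apply: ler_sum => v _.
rewrite exchange_big /= big_nat_cond [leRHS]big_nat_cond.
apply: ler_sum => m /andP[/andP[m_gt0 _] _].
apply: sum_delta_le; first exact: iota_uniq.
by apply: H_ge0; rewrite muln_gt0 expn_gt0 prime_gt0.
Qed.

Lemma powD_ge_tangent (R : realDomainType) (a w : R) (j : nat) :
  0 <= a -> 0 <= w -> a ^+ j.+1 + j.+1%:R * (w * a ^+ j) <= (a + w) ^+ j.+1.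
Proof.
move=> a_ge0 w_ge0; elim: j => [|j IHj].
  by rewrite !expr1 expr0 mul1r mulr1.
rewrite [(a + w) ^+ _]exprS.
apply: le_trans (ler_wpM2l (addr_ge0 a_ge0 w_ge0) IHj).
have aj_ge0 : 0 <= j.+1%:R * (w * (w * a ^+ j)).
  by rewrite !mulr_ge0 ?exprn_ge0.
rewrite -subr_ge0; apply: (le_trans aj_ge0).
rewrite le_eqVlt; apply/orP; left; apply/eqP.
by rewrite !exprS -[j.+2]addn1 natrD; ring.
Qed.

(** One step of a telescoping sum: the left-hand side is the start of the
    binomial expansion of the right-hand side. *)
Lemma powD_fact_step (R : realFieldType) (a w : R) (j : nat) :
  0 <= a -> 0 <= w ->
  a ^+ j.+1 / j.+1`!%:R + w * (a ^+ j / j`!%:R) <= (a + w) ^+ j.+1 / j.+1`!%:R.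
Proof.
move=> a_ge0 w_ge0; rewrite ler_pdivlMr ?ltr0n ?fact_gt0 //.
apply: le_trans (powD_ge_tangent j a_ge0 w_ge0).
rewrite factS natrM.
have j_neq0 : j.+1%:R != 0 :> R by rewrite pnatr_eq0.
have f_neq0 : j`!%:R != 0 :> R by rewrite pnatr_eq0 -lt0n fact_gt0.
rewrite le_eqVlt; apply/orP; left; apply/eqP; field.
by rewrite f_neq0 nat1r j_neq0.
Qed.

Definition prime_sum_lt (R : nmodType) (w : nat -> R) (z : nat) : R :=
  \sum_(0 <= p < z | prime p) w p.

Lemma prime_sum_ltS (R : nmodType) (w : nat -> R) (z : nat) :
  prime_sum_lt w z.+1 = prime_sum_lt w z + (if prime z then w z else 0).
Proof. by rewrite /prime_sum_lt big_mkcond big_nat_recr // -big_mkcond. Qed.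

Lemma prime_sum_lt_ge0 (R : numDomainType) (w : nat -> R) (z : nat) :
  (forall p, prime p -> 0 <= w p) -> 0 <= prime_sum_lt w z.
Proof. by move=> w_ge0; apply: sumr_ge0. Qed.

(** The discrete form of the integral of V^j / j! against dV. It recovers the
    factorial that is lost when a sum is split according to a largest prime. *)
Lemma sum_prime_pow_fact_le (R : realFieldType) (w : nat -> R) (c : R)
    (j z : nat) :
  0 <= c -> (forall p, prime p -> 0 <= w p) ->
  prime_sum_lt (fun q => w q * ((c + prime_sum_lt w q) ^+ j / j`!%:R)) z
  <= (c + prime_sum_lt w z) ^+ j.+1 / j.+1`!%:R.
Proof.
move=> c_ge0 w_ge0; elim: z => [|z IHz].
  rewrite /prime_sum_lt !big_geq // divr_ge0 ?exprn_ge0 ?ler0n //.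
  by rewrite addr_ge0.
rewrite !prime_sum_ltS; case: ifP => z_pr; last by rewrite !addr0.
rewrite addrA; apply: le_trans (powD_fact_step _ _ (w_ge0 _ z_pr)).
  by rewrite lerD2r.
by rewrite addr_ge0 // sumr_ge0.
Qed.

Lemma omega_eq0 (n : nat) : (0 < n)%N -> (omega n == 0)%N = (n == 1)%N.
Proof.
move=> n_gt0; apply/idP/idP => [|/eqP->//].
rewrite size_eq0 => /eqP n_pr; rewrite eqn_leq n_gt0 andbT leqNgt.
by rewrite -pi_max_pdiv /pi_of /= inE /= n_pr.
Qed.

(** Peeling off the largest primes one after the other orders the prime factors
    of r; this ordering is the source of the factor 1 / j!. *)
Lemma sum_stratum_le (R : realFieldType) (h : nat -> R) (N j z : nat) :
  (forall n, (0 < n)%N -> 0 <= h n) -> h 1%N <= 1 ->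
  (forall q v r, prime q -> (0 < v)%N -> (0 < r)%N -> coprime q r ->
    h (q ^ v * r)%N = h (q ^ v)%N * h r) ->
  \sum_(1 <= r < N.+1 | stratum j z r) h r <=
  (prime_sum_lt (fun p => \sum_(1 <= v < N.+1) h (p ^ v)%N) z) ^+ j / j`!%:R.
Proof.
move=> h_ge0 h1 hM.
set w := (X in prime_sum_lt X).
have w_ge0 p : prime p -> 0 <= w p.
  move=> p_pr; apply: sumr_ge0 => v _; apply: h_ge0.
  by rewrite expn_gt0 prime_gt0.
elim: j z => [|j IHj] z.
  rewrite expr0 fact0 divr1.
  have := @sum_delta_le R _ (index_iota 1 N.+1) (stratum 0 z) 1%N 1
    (iota_uniq _ _) ler01.
  apply: le_trans; rewrite big_nat_cond [leRHS]big_nat_cond.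
  apply: ler_sum => r /andP[/andP[r_gt0 _] /andP[r_om _]].
  by move: r_om; rewrite omega_eq0 // => /eqP->; rewrite eqxx.
apply: le_trans (sum_by_largest_prime _ _ _ h_ge0) _.
have := sum_prime_pow_fact_le j z (lexx 0) w_ge0.
rewrite add0r; apply: le_trans; apply: ler_sum => q q_pr.
rewrite add0r; apply: le_trans (ler_wpM2l (w_ge0 _ q_pr) (IHj q)).
rewrite /w mulr_suml big_nat_cond [leRHS]big_nat_cond.
apply: ler_sum => v /andP[/andP[v_gt0 _] _].
rewrite big_distrr /= big_mkcondr big_nat_cond [leRHS]big_nat_cond.
apply: ler_sum => r /andP[/andP[r_gt0 _] _].
case: ifP => [qr|_]; first by rewrite hM.
by rewrite mulr_ge0 ?h_ge0 // expn_gt0 prime_gt0.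
Qed.
(** * Elementary estimates for primes and exponentials *)

Lemma ln_prod_nat (R : realType) (I : Type) (s : seq I) (P : pred I)
    (F : I -> nat) :
  (forall i, P i -> (0 < F i)%N) ->
  ln (\prod_(i <- s | P i) F i)%N%:R = \sum_(i <- s | P i) ln (F i)%:R :> R.
Proof.
move=> F_gt0.
have [] // : ln (\prod_(i <- s | P i) F i)%N%:R
    = \sum_(i <- s | P i) ln (F i)%:R :> R /\ (0 < \prod_(i <- s | P i) F i)%N.
elim/big_rec2: _ => [|i y m Pi [<- m_gt0]]; first by rewrite ln1.
by rewrite natrM lnM ?posrE ?ltr0n ?F_gt0 // muln_gt0 F_gt0.
Qed.

(** The exponent of p in n! is at least the number of multiples of p up to n. *)
Lemma prod_prime_pow_le_fact (n : nat) :
  (\prod_(0 <= p < n.+1 | prime p) p ^ (n %/ p) <= n`!)%N.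
Proof.
have n_le : (n <= n`!)%N.
  by case: n => // n; rewrite factS leq_pmulr ?fact_gt0.
rewrite -[leqRHS](partnT (fact_gt0 n)) /partn.
rewrite [leqRHS](big_cat_nat _ (n := n.+1)) //=.
apply: leq_trans (leq_pmulr _ _); last first.
  by apply: prodn_gt0 => p; exact: pfactor_gt0.
rewrite big_mkcond /=; apply: leq_prod => p _.
case: ifP => [p_pr|_]; last first.
  exact: pfactor_gt0.
rewrite leq_exp2l ?prime_gt1 // logn_fact //.
case: n {n_le} => [|n]; first by rewrite div0n.
by rewrite big_ltn // expn1 leq_addr.
Qed.

(** The weak form of Mertens' first theorem, read off the factorization of n!:
    for p <= n the integer part of n / p is at least n / (2 p). *)
Lemma sum_ln_prime_div_le (R : realType) (n : nat) : (0 < n)%N ->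
  prime_sum_lt (fun p => ln p%:R / p%:R) n.+1 <= 2 * ln n%:R :> R.
Proof.
move=> n_gt0.
have n_gt0R : 0 < n%:R :> R by rewrite ltr0n.
have fact_le : (n`! <= n ^ n)%N.
  rewrite fact_prod -[X in (n ^ X)%N](subn1 n.+1) -prod_nat_const_nat.
  rewrite big_nat_cond [leqRHS]big_nat_cond.
  by apply: leq_prod => i /andP[/andP[_ i_le] _].
have key : prime_sum_lt (fun p => (n %/ p)%:R * ln p%:R) n.+1
    <= n%:R * ln n%:R :> R.
  have prod_gt0 : (0 < \prod_(0 <= p < n.+1 | prime p) p ^ (n %/ p))%N.
    by apply: prodn_cond_gt0 => p p_pr; rewrite expn_gt0 prime_gt0.
  have := leq_trans (prod_prime_pow_le_fact n) fact_le.
  rewrite -(@ler_nat R) => prod_le.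
  have : ln (\prod_(0 <= p < n.+1 | prime p) p ^ (n %/ p))%N%:R
      <= ln (n ^ n)%N%:R :> R.
    by rewrite ler_ln // posrE ltr0n // expn_gt0 n_gt0.
  rewrite ln_prod_nat; last by move=> p p_pr; rewrite expn_gt0 prime_gt0.
  rewrite natrX lnXn // mulr_natl; apply: le_trans.
  rewrite le_eqVlt; apply/orP; left; apply/eqP; apply: eq_bigr => p p_pr.
  by rewrite natrX lnXn ?mulr_natl // ltr0n prime_gt0.
rewrite -(ler_pM2l n_gt0R) mulrCA.
apply: (@le_trans _ _ (2 * prime_sum_lt (fun p => (n %/ p)%:R * ln p%:R) n.+1));
  last by rewrite ler_pM2l.
rewrite /prime_sum_lt !big_distrr /= big_nat_cond [leRHS]big_nat_cond.
apply: ler_sum => p /andP[/andP[_ p_le] p_pr].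
have p_gt0 := prime_gt0 p_pr.
have lnp_ge0 : 0 <= ln p%:R :> R by rewrite ln_ge0 // ler1n.
rewrite mulrCA [leLHS]mulrC mulrA; apply: ler_wpM2r => //.
rewrite ler_pdivrMr ?ltr0n // -!natrM ler_nat.
have := divn_eq n p; have := ltn_pmod n p_gt0.
have : (0 < n %/ p)%N by rewrite divn_gt0.
nia.
Qed.

Lemma sum_geometric_le (R : realFieldType) (t : R) (m n : nat) :
  0 <= t -> t < 1 -> \sum_(m <= v < n) t ^+ v <= t ^+ m / (1 - t).
Proof.
move=> t_ge0 t_lt1; have t1_gt0 : 0 < 1 - t by rewrite subr_gt0.
rewrite ler_pdivlMr //; have [n_le|m_lt] := leqP n m.
  by rewrite big_geq // mul0r exprn_ge0.
suff key d :
    (\sum_(m <= v < m + d) t ^+ v) * (1 - t) = t ^+ m - t ^+ (m + d).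
  by rewrite -(subnKC (ltnW m_lt)) key gerBl exprn_ge0.
elim: d => [|d IHd]; first by rewrite addn0 big_geq // mul0r subrr.
by rewrite addnS big_nat_recr ?leq_addr //= mulrDl IHd exprS; ring.
Qed.

(** All integers p >= 2 are compared with the telescoping sum of
    1 / (p (p - 1)). *)
Lemma sum_inv_prime_sqr_le (R : realFieldType) (z : nat) :
  prime_sum_lt (fun p => (p%:R ^+ 2)^-1) z <= 1 :> R.
Proof.
(* The bound at n.+2 concerns the p <= n + 1, and is an equality for n = 0. *)
have key n : prime_sum_lt (fun p => (p%:R ^+ 2)^-1) n.+2 <= 1 - n.+1%:R^-1 :> R.
  elim: n => [|n IHn].
    by rewrite !prime_sum_ltS /prime_sum_lt big_geq //= !addr0 invr1 subrr.
  rewrite prime_sum_ltS; apply: le_trans (lerD IHn (lexx _)) _.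
  apply: (@le_trans _ _ (1 - n.+1%:R^-1 + (n.+2%:R ^+ 2)^-1)).
    by rewrite lerD2l; case: ifP => // _; rewrite invr_ge0 exprn_ge0.
  have -> : n.+1%:R = n.+2%:R - 1 :> R by rewrite -[n.+2]addn1 natrD addrK.
  have : 2 <= n.+2%:R :> R by rewrite ler_nat.
  move: (n.+2%:R : R) => y y_ge2.
  have y_gt0 : 0 < y by lra.
  have y1_gt0 : 0 < y - 1 by lra.
  rewrite -addrA lerD2l -subr_ge0.
  have -> : - y^-1 - (- (y - 1)^-1 + (y ^+ 2)^-1) = ((y - 1) * y ^+ 2)^-1.
    by field; rewrite !gt_eqF.
  by rewrite invr_ge0 mulr_ge0 ?exprn_ge0 // ltW.
case: z => [|[|n]].
- by rewrite /prime_sum_lt big_geq.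
- by rewrite prime_sum_ltS /prime_sum_lt big_geq //= addr0.
- by apply: le_trans (key n) _; rewrite gerBl invr_ge0.
Qed.

(** The left-hand side is largest at u = mu / c; the bound drops the factor
    exp (- mu) from its value there. *)
Lemma powR_expR_bounded (R : realType) (mu c u : R) :
  0 < mu -> 0 < c -> 0 < u -> u `^ mu * expR (- (c * u)) <= (mu / c) `^ mu.
Proof.
move=> mu_gt0 c_gt0 u_gt0.
have mc_gt0 : 0 < mu / c by rewrite divr_gt0.
rewrite /powR !gt_eqF // -expRD ler_expR.
have := @le_ln1Dx R (u / (mu / c) - 1).
rewrite addrCA subrr addr0 ln_div ?posrE //.
have -> : u / (mu / c) = c * u / mu by field; rewrite !gt_eqF.
have t_gt0 : 0 < c * u / mu by rewrite divr_gt0 ?mulr_gt0.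
rewrite ltrBrDr addNr => /(_ t_gt0).
move/(ler_wpM2l (ltW mu_gt0)).
have -> : mu * (c * u / mu - 1) = c * u - mu by field; rewrite gt_eqF.
lra.
Qed.

(** From exp (- y) >= 1 - y. *)
Lemma expR_le_1D2x (R : realType) (y : R) :
  0 <= y -> y <= 4^-1 -> expR y <= 1 + 2 * y.
Proof.
move=> y_ge0 y_le.
have := expR_ge1Dx (- y); rewrite expRN.
have e_gt0 := expR_gt0 y.
rewrite -(ler_pM2r e_gt0) mulVf ?gt_eqF // => le1.
nra.
Qed.

Lemma powR_prime_le (R : realType) (p : nat) (theta : R) : prime p ->
  0 <= theta -> theta * ln p%:R <= 4^-1 ->
  p%:R `^ theta <= 1 + 2 * theta * ln p%:R.
Proof.
move=> p_pr th_ge0 th_le.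
rewrite /powR pnatr_eq0 gtn_eqF ?prime_gt0 //.
rewrite -mulrA; apply: expR_le_1D2x => //.
by rewrite mulr_ge0 // ln_ge0 // ler1n prime_gt0.
Qed.

(** * Rankin's method for functions of the class scrG *)

(** The weight of Rankin's method. *)
Definition twist (R : realType) (g : nat -> R) (theta : R) (n : nat) : R :=
  g n * n%:R `^ theta.

Lemma twist0 (R : realType) (g : nat -> R) (n : nat) : twist g 0 n = g n.
Proof. by rewrite /twist powRr0 mulr1. Qed.

Lemma twistM (R : realType) (g : nat -> R) (theta : R) (m n : nat) :
  arith_multiplicative g -> (0 < m)%N -> (0 < n)%N -> coprime m n ->
  twist g theta (m * n)%N = twist g theta m * twist g theta n.
Proof.
move=> [_ gM] m_gt0 n_gt0 mn; rewrite /twist gM // natrM powRM ?ler0n //.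
by rewrite mulrACA.
Qed.

Lemma twist_ge0 (R : realType) (A : R) (g : nat -> R) (theta : R) (n : nat) :
  scrG A g -> (0 < n)%N -> 0 <= twist g theta n.
Proof. by move=> [_ g_ge0 _] n_gt0; rewrite mulr_ge0 ?powR_ge0 ?g_ge0. Qed.

(** The hypothesis on theta gives p^theta <= 3/2 < 2, so the prime powers still
    form a convergent geometric series, even for p = 2. *)
Lemma twist_prime_pow_le (R : realType) (A : R) (g : nat -> R) (theta : R)
    (p v : nat) :
  scrG A g -> prime p -> (0 < v)%N -> 0 <= theta -> theta * ln p%:R <= 4^-1 ->
  twist g theta (p ^ v)%N <= A * (3 / 2 / p%:R) ^+ v.
Proof.
move=> [_ g_ge0 g_le] p_pr v_gt0 th_ge0 th_le.
have p_gt0 : 0 < p%:R :> R by rewrite ltr0n prime_gt0.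
have pth_le : p%:R `^ theta <= 3 / 2.
  by apply: le_trans (powR_prime_le p_pr th_ge0 th_le) _; lra.
have -> : A * (3 / 2 / p%:R) ^+ v = A / (p ^ v)%:R * (3 / 2) ^+ v.
  by rewrite natrX expr_div_n; field; rewrite expf_neq0 // gt_eqF.
rewrite /twist; apply: ler_pM; rewrite ?powR_ge0 ?g_le //.
  by rewrite g_ge0 // expn_gt0 prime_gt0.
rewrite natrX -powR_mulrn ?ler0n // -powRrM mulrC powRrM.
rewrite powR_mulrn ?powR_ge0 //.
by rewrite lerXn2r // nnegrE ?powR_ge0 //; lra.
Qed.

Lemma sum_twist_prime_pow_le (R : realType) (A : R) (g : nat -> R) (theta : R)
    (p N m : nat) :
  0 < A -> scrG A g -> prime p -> 0 <= theta -> theta * ln p%:R <= 4^-1 ->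
  (0 < m)%N ->
  \sum_(m <= v < N) twist g theta (p ^ v)%N <= 4 * A * (3 / 2 / p%:R) ^+ m.
Proof.
move=> A_gt0 gG p_pr th_ge0 th_le m_gt0.
have p_gt0 : 0 < p%:R :> R by rewrite ltr0n prime_gt0.
have p_ge2 : 2 <= p%:R :> R by rewrite ler_nat prime_gt1.
set t := 3 / 2 / p%:R.
have t_ge0 : 0 <= t by rewrite divr_ge0 //; lra.
have t_le : t <= 3 / 4 by rewrite /t ler_pdivrMr //; lra.
have t_lt1 : t < 1 by lra.
apply: (@le_trans _ _ (A * \sum_(m <= v < N) t ^+ v)).
  rewrite mulr_sumr big_nat_cond [leRHS]big_nat_cond.
  apply: ler_sum => v /andP[/andP[v_ge _] _].
  by apply: twist_prime_pow_le => //; apply: leq_trans v_ge.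
rewrite [4 * A]mulrC -mulrA ler_pM2l //.
apply: le_trans (sum_geometric_le m N t_ge0 t_lt1) _.
rewrite mulrC; apply: ler_wpM2r; first exact: exprn_ge0.
by rewrite -[leLHS]div1r ler_pdivrMr; lra.
Qed.

Lemma sum_twist_local_le (R : realType) (A : R) (g : nat -> R) (theta : R)
    (p N : nat) :
  0 < A -> scrG A g -> prime p -> 0 <= theta -> theta * ln p%:R <= 4^-1 ->
  \sum_(1 <= v < N.+1) twist g theta (p ^ v)%N
  <= p%:R `^ theta * g p + 9 * A / p%:R ^+ 2.
Proof.
move=> A_gt0 gG p_pr th_ge0 th_le; have [_ g_ge0 _] := gG.
have p_gt0 : 0 < p%:R :> R by rewrite ltr0n prime_gt0.
case: N => [|N].
  rewrite big_geq // addr_ge0 ?mulr_ge0 ?powR_ge0 ?g_ge0 ?prime_gt0 //.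
  exact: ltW.
rewrite big_ltn // expn1 {1}/twist mulrC lerD2l.
apply: le_trans (sum_twist_prime_pow_le _ A_gt0 gG p_pr th_ge0 th_le _) _ => //.
rewrite le_eqVlt; apply/orP; left; apply/eqP.
by field; rewrite gt_eqF.
Qed.

(** The contribution of the powers of p up to the factor p^theta: the second
    term accounts for the exponents v >= 2, uniformly in theta. *)
Definition local_weight (R : realType) (A : R) (g : nat -> R) (p : nat) : R :=
  g p + 9 * A / p%:R ^+ 2.

Lemma local_weight_ge0 (R : realType) (A : R) (g : nat -> R) (p : nat) :
  0 < A -> scrG A g -> prime p -> 0 <= local_weight A g p.
Proof.
move=> A_gt0 [_ g_ge0 _] p_pr.
by rewrite addr_ge0 ?g_ge0 ?prime_gt0 // divr_ge0 // mulr_ge0 // ltW.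
Qed.

Lemma prime_sum_lt_weight_le (R : realType) (A : R) (g : nat -> R) (z : nat) :
  0 < A ->
  prime_sum_lt (local_weight A g) z <= prime_sum_lt g z + 9 * A.
Proof.
move=> A_gt0; rewrite /prime_sum_lt big_split lerD2l /= -mulr_sumr.
rewrite -[leRHS]mulr1 ler_pM2l ?mulr_gt0 //.
exact: sum_inv_prime_sqr_le.
Qed.

(** The twist replaces g p by at most (1 + 2 theta log p) g p, and
    g p <= A / p. *)
Lemma prime_sum_lt_twist_le (R : realType) (A : R) (g : nat -> R) (theta : R)
    (N z : nat) :
  0 < A -> scrG A g -> 0 <= theta ->
  (forall p, prime p -> (p < z)%N -> theta * ln p%:R <= 4^-1) ->
  prime_sum_lt (fun p => \sum_(1 <= v < N.+1) twist g theta (p ^ v)%N) z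
  <= 2 * theta * A * prime_sum_lt (fun p => ln p%:R / p%:R) z
     + prime_sum_lt (local_weight A g) z.
Proof.
move=> A_gt0 gG th_ge0 th_le; have [_ g_ge0 g_le] := gG.
rewrite /prime_sum_lt mulr_sumr -big_split /= big_nat_cond [leRHS]big_nat_cond.
apply: ler_sum => p /andP[/andP[_ pz] p_pr].
have p_gt0 : 0 < p%:R :> R by rewrite ltr0n prime_gt0.
have thp_le := th_le p p_pr pz.
apply: le_trans (sum_twist_local_le _ A_gt0 gG p_pr th_ge0 thp_le) _.
rewrite /local_weight addrA lerD2r.
have gp_ge0 : 0 <= g p by rewrite g_ge0 // prime_gt0.
apply: le_trans (ler_wpM2r gp_ge0 (powR_prime_le p_pr th_ge0 thp_le)) _.
rewrite mulrDl mul1r [leLHS]addrC lerD2r.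
have := g_le p 1%N p_pr isT; rewrite expn1 => gp_le.
have lnp_ge0 : 0 <= ln p%:R :> R by rewrite ln_ge0 // ler1n prime_gt0.
have -> : 2 * theta * A * (ln p%:R / p%:R) = 2 * theta * ln p%:R * (A / p%:R).
  by ring.
by apply: ler_wpM2l => //; rewrite !mulr_ge0.
Qed.

(** The case theta = 0, in which the twist is trivial. *)
Lemma sum_stratum_scrG_le (R : realType) (A : R) (g : nat -> R) (N j z : nat) :
  0 < A -> scrG A g ->
  \sum_(1 <= r < N.+1 | stratum j z r) g r
  <= (prime_sum_lt (local_weight A g) z) ^+ j / j`!%:R.
Proof.
move=> A_gt0 gG; have [[g1 gM] g_ge0 _] := gG.
apply: le_trans (sum_stratum_le _ _ _ g_ge0 _ _) _; first by rewrite g1.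
  move=> q v r q_pr v_gt0 r_gt0 qr.
  by rewrite gM ?coprimeXl // expn_gt0 prime_gt0.
apply: ler_wpM2r; first by rewrite invr_ge0.
apply: lerXn2r; rewrite ?nnegrE.
- apply: sumr_ge0 => p p_pr; apply: sumr_ge0 => v _.
  by rewrite g_ge0 // expn_gt0 prime_gt0.
- by apply: sumr_ge0 => p p_pr; exact: local_weight_ge0.
- have := @prime_sum_lt_twist_le R A g 0 N z A_gt0 gG (lexx _).
  rewrite mulr0 !mul0r add0r; under eq_fun => p do
    under eq_bigr => v _ do rewrite twist0.
  by apply=> p _ _; rewrite mul0r invr_ge0.
Qed.

(** With this exponent p^theta <= exp (1/4) for all p <= q. *)
Definition rankin_exponent (R : realType) (q : nat) : R := (4 * ln q%:R)^-1.

(** By the choice of theta, the bound 2 theta A (2 log q) for the effect of the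
    twist is exactly A, whatever q is. *)
Lemma sum_stratum_twist_le (R : realType) (A : R) (g : nat -> R)
    (N j q : nat) :
  0 < A -> scrG A g -> prime q ->
  \sum_(1 <= r < N.+1 | stratum j q r) twist g (rankin_exponent R q) r
  <= (A + prime_sum_lt (local_weight A g) q) ^+ j / j`!%:R.
Proof.
move=> A_gt0 gG q_pr; have [g_mul g_ge0 _] := gG.
have lnq_gt0 : 0 < ln q%:R :> R by rewrite ln_gt0 // ltr1n prime_gt1.
set theta := rankin_exponent R q.
have th_gt0 : 0 < theta by rewrite invr_gt0 mulr_gt0.
have th_le p : prime p -> (p < q)%N -> theta * ln p%:R <= 4^-1.
  move=> p_pr pq; rewrite /theta /rankin_exponent invfM -mulrA ger_pMr //.
  rewrite mulrC ler_pdivrMr // mul1r ler_ln ?posrE ?ltr0n ?prime_gt0 //.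
  by rewrite ler_nat ltnW.
apply: le_trans (sum_stratum_le _ _ _ _ _ _) _.
- by move=> n; exact: twist_ge0 gG.
- by rewrite /twist powR1 mulr1; case: g_mul => ->.
- move=> p v r p_pr v_gt0 r_gt0 pr.
  by rewrite twistM ?coprimeXl // expn_gt0 prime_gt0.
apply: ler_wpM2r; first by rewrite invr_ge0.
apply: lerXn2r; rewrite ?nnegrE.
- apply: sumr_ge0 => p p_pr; apply: sumr_ge0 => v _.
  by rewrite (twist_ge0 _ gG) // expn_gt0 prime_gt0.
- apply: addr_ge0; first exact: ltW.
  by apply: prime_sum_lt_ge0 => p p_pr; exact: local_weight_ge0.
apply: le_trans (prime_sum_lt_twist_le N A_gt0 gG (ltW th_gt0) th_le) _.
rewrite lerD2r.
have sum_le : prime_sum_lt (fun p => ln p%:R / p%:R) q <= 2 * ln q%:R :> R.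
  apply: le_trans (sum_ln_prime_div_le _ (prime_gt0 q_pr)).
  rewrite prime_sum_ltS lerDl q_pr divr_ge0 //; exact: ltW.
apply: (@le_trans _ _ (2 * theta * A * (2 * ln q%:R))).
  by apply: ler_wpM2l => //; rewrite !mulr_ge0 // ltW.
rewrite le_eqVlt; apply/orP; left; apply/eqP.
by rewrite /theta /rankin_exponent; field; rewrite gt_eqF.
Qed.

(** * The contribution of large r *)

(** The summand over the r > x^(1/4) that can occur in the fibration. *)
Definition large_part (R : realType) (x lambda : R) (s : nat) (g : nat -> R)
    (r : nat) : R :=
  if (x `^ 4^-1 < r%:R) && all (fun p => (p * r * s)%:R <= x) (primes r)
  then g r / ln (2 * x / (r * s)%:R) `^ lambda else 0.

(** Here 1/16 is 1/4, from the threshold x^(1/4), times 1/4, from the Rankin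
    exponent. *)
Definition decay (R : realType) (x lambda : R) (q : nat) : R :=
  expR (- (16^-1 * (ln x / ln q%:R))) / ln q%:R `^ lambda.

Lemma decay_ge0 (R : realType) (x lambda : R) (q : nat) :
  0 <= decay x lambda q.
Proof. by rewrite divr_ge0 ?powR_ge0 ?expR_ge0. Qed.

(** With u = log x / log q this says that u^lambda exp (- u / 16) is bounded. *)
Lemma decay_le (R : realType) (x lambda : R) (q : nat) :
  prime q -> 1 < x -> 0 < lambda ->
  decay x lambda q <= (16 * lambda) `^ lambda / ln x `^ lambda.
Proof.
move=> q_pr x_gt1 l_gt0.
have lnq_gt0 : 0 < ln q%:R :> R by rewrite ln_gt0 // ltr1n prime_gt1.
have lnx_gt0 : 0 < ln x by rewrite ln_gt0.
have c_gt0 : 0 < 16^-1 :> R by rewrite invr_gt0.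
have := powR_expR_bounded l_gt0 c_gt0 (divr_gt0 lnx_gt0 lnq_gt0).
rewrite invrK [lambda * 16]mulrC ler_pdivlMr ?powR_gt0 //; apply: le_trans.
have inv_pow : (ln q%:R)^-1 `^ lambda = (ln q%:R `^ lambda)^-1 :> R.
  by rewrite -[in LHS]powR_inv1 ?ltW // -powRrM mulN1r powRN.
rewrite /decay powRM ?invr_ge0 ?(ltW lnx_gt0) ?(ltW lnq_gt0) // inv_pow.
by rewrite le_eqVlt; apply/orP; left; apply/eqP; ring.
Qed.

(** The same as [decay_le], with one more power of u = log x / log q spent to
    gain the factor 1 / u. *)
Lemma decay_le_ln (R : realType) (x lambda : R) (q : nat) :
  prime q -> 1 < x -> 0 < lambda ->
  decay x lambda q
  <= (16 * (lambda + 1)) `^ (lambda + 1) / ln x `^ lambda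
     * (ln q%:R / ln x).
Proof.
move=> q_pr x_gt1 l_gt0.
have lnq_gt0 : 0 < ln q%:R :> R by rewrite ln_gt0 // ltr1n prime_gt1.
have lnx_gt0 : 0 < ln x by rewrite ln_gt0.
have l1_gt0 : 0 < lambda + 1 by rewrite addr_gt0.
have powS y : 0 < y -> y `^ (lambda + 1) = y `^ lambda * y :> R.
  by move=> y_gt0; rewrite powRD ?powRr1 ?(ltW y_gt0) // gt_eqF ?implybT.
have -> : decay x lambda q = decay x (lambda + 1) q * ln q%:R.
  by rewrite /decay powS //; field; rewrite !gt_eqF ?powR_gt0.
have -> (K : R) : K / ln x `^ lambda * (ln q%:R / ln x)
    = K / ln x `^ (lambda + 1) * ln q%:R.
  by rewrite powS //; field; rewrite !gt_eqF ?powR_gt0.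
by apply: ler_wpM2r; [exact: ltW | exact: decay_le].
Qed.

Lemma large_part_ge0 (R : realType) (A x lambda : R) (s : nat) (g : nat -> R)
    (r : nat) :
  scrG A g -> (0 < r)%N -> 0 <= large_part x lambda s g r.
Proof.
move=> [_ g_ge0 _] r_gt0; rewrite /large_part; case: ifP => // _.
by rewrite divr_ge0 ?powR_ge0 ?g_ge0.
Qed.

Lemma rankin_exponent_gt0 (R : realType) (q : nat) :
  prime q -> 0 < rankin_exponent R q.
Proof.
by move=> q_pr; rewrite invr_gt0 mulr_gt0 // ln_gt0 // ltr1n prime_gt1.
Qed.

(** For m = q^v r in the range of [large_part] one has q m s <= x, so that
    log (2 x / (m s)) >= log q, and (m / x^(1/4))^theta >= 1. *)
Lemma large_part_le (R : realType) (A x lambda : R) (s : nat) (g : nat -> R)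
    (q v r : nat) :
  scrG A g -> 1 < x -> 0 < lambda -> (0 < s)%N ->
  prime q -> (0 < v)%N -> (0 < r)%N -> coprime q r ->
  large_part x lambda s g (q ^ v * r)
  <= decay x lambda q * (twist g (rankin_exponent R q) (q ^ v)%N
                         * twist g (rankin_exponent R q) r).
Proof.
move=> gG x_gt1 l_gt0 s_gt0 q_pr v_gt0 r_gt0 qr; have [g_mul g_ge0 _] := gG.
have qv_gt0 : (0 < q ^ v)%N by rewrite expn_gt0 prime_gt0.
have lnq_gt0 : 0 < ln q%:R :> R by rewrite ln_gt0 // ltr1n prime_gt1.
have x_gt0 : 0 < x by lra.
rewrite -twistM ?coprimeXl //; set m := (q ^ v * r)%N.
have m_gt0 : (0 < m)%N by rewrite muln_gt0 qv_gt0.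
rewrite /large_part; case: ifP => [/andP[m_gt /allP m_le]|_]; last first.
  by rewrite mulr_ge0 ?decay_ge0 ?(twist_ge0 _ gG).
have ms_gt0 : 0 < (m * s)%:R :> R by rewrite ltr0n muln_gt0 m_gt0.
have q_in : q \in primes m.
  by rewrite mem_primes q_pr m_gt0 dvdn_mulr // dvdn_exp.
have ln_ge : ln q%:R <= ln (2 * x / (m * s)%:R).
  rewrite ler_ln ?posrE ?ltr0n ?prime_gt0 ?divr_gt0 ?mulr_gt0 //.
  rewrite ler_pdivlMr // -natrM mulnA.
  by apply: le_trans (m_le _ q_in) _; lra.
have twist_ge : g m * expR (16^-1 * (ln x / ln q%:R))
    <= twist g (rankin_exponent R q) m.
  apply: ler_wpM2l; first exact: g_ge0.
  have -> : expR (16^-1 * (ln x / ln q%:R))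
      = (x `^ 4^-1) `^ rankin_exponent R q.
    rewrite -powRrM /powR gt_eqF // /rankin_exponent; congr expR.
    by field; rewrite gt_eqF.
  apply: ge0_ler_powR; rewrite ?nnegrE ?powR_ge0 ?ler0n //.
    exact/ltW/rankin_exponent_gt0.
  exact: ltW.
apply: (@le_trans _ _ (g m / ln q%:R `^ lambda)).
  apply: ler_wpM2l; first exact: g_ge0.
  rewrite lef_pV2 ?posrE ?powR_gt0 //; last exact: lt_le_trans ln_ge.
  apply: ge0_ler_powR; rewrite ?nnegrE //; try exact: ltW.
  by apply/ltW; exact: lt_le_trans ln_ge.
apply: le_trans (ler_wpM2l (decay_ge0 _ _ _) twist_ge).
rewrite /decay expRN le_eqVlt; apply/orP; left; apply/eqP.
by field; rewrite !gt_eqF ?powR_gt0 ?expR_gt0.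
Qed.

Lemma sum_large_part_le (R : realType) (A x lambda : R) (s : nat)
    (g : nat -> R) (N j z : nat) :
  0 < A -> scrG A g -> 1 < x -> 0 < lambda -> (0 < s)%N ->
  \sum_(1 <= r < N.+1 | stratum j.+1 z r) large_part x lambda s g r
  <= prime_sum_lt (fun q => decay x lambda q
       * (\sum_(1 <= v < N.+1) twist g (rankin_exponent R q) (q ^ v)%N)
       * ((A + prime_sum_lt (local_weight A g) q) ^+ j / j`!%:R)) z.
Proof.
move=> A_gt0 gG x_gt1 l_gt0 s_gt0.
apply: le_trans (sum_by_largest_prime _ _ _ _) _.
  by move=> r; exact: large_part_ge0 gG.
apply: ler_sum => q q_pr.
have S_ge0 : 0 <= \sum_(1 <= v < N.+1) twist g (rankin_exponent R q) (q ^ v)%N.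
  apply: sumr_ge0 => v _.
  by rewrite (twist_ge0 _ gG) // expn_gt0 prime_gt0.
apply: le_trans (ler_wpM2l (mulr_ge0 (decay_ge0 x lambda q) S_ge0)
  (sum_stratum_twist_le N j A_gt0 gG q_pr)).
rewrite -mulrA mulr_suml mulr_sumr big_nat_cond [leRHS]big_nat_cond.
apply: ler_sum => v /andP[/andP[v_gt0 _] _].
rewrite mulrA mulr_sumr big_mkcondr big_nat_cond [leRHS]big_nat_cond.
apply: ler_sum => r /andP[/andP[r_gt0 _] _].
case: ifP => [qr|_].
  by rewrite -mulrA; exact: large_part_le gG _ _ _ _ _ _ _.
rewrite -mulrA; apply: mulr_ge0; first exact: decay_ge0.
by apply: mulr_ge0; apply: twist_ge0 gG _ => //; rewrite expn_gt0 prime_gt0.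
Qed.

Lemma rankin_exponent_ln (R : realType) (q : nat) :
  prime q -> rankin_exponent R q * ln q%:R = 4^-1.
Proof.
move=> q_pr; have lnq_gt0 : 0 < ln q%:R :> R.
  by rewrite ln_gt0 // ltr1n prime_gt1.
by rewrite /rankin_exponent; field; rewrite gt_eqF.
Qed.

(** For omega r = j + 1 the local sum at q is at most 3/2 times the local weight
    of q, and the sum over q telescopes, so the full power j + 1 comes with its
    factorial. *)
Lemma sum_large_part_le_powS (R : realType) (A x lambda : R) (s : nat)
    (g : nat -> R) (N j z : nat) :
  0 < A -> scrG A g -> 1 < x -> 0 < lambda -> (0 < s)%N ->
  \sum_(1 <= r < N.+1 | stratum j.+1 z r) large_part x lambda s g r
  <= 3 / 2 * (16 * lambda) `^ lambda / ln x `^ lambda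
     * ((A + prime_sum_lt (local_weight A g) z) ^+ j.+1 / j.+1`!%:R).
Proof.
move=> A_gt0 gG x_gt1 l_gt0 s_gt0; have [_ g_ge0 _] := gG.
apply: le_trans (sum_large_part_le _ _ _ A_gt0 gG x_gt1 l_gt0 s_gt0) _.
have w_ge0 p : prime p -> 0 <= local_weight A g p.
  by move=> p_pr; exact: local_weight_ge0.
have K_ge0 : 0 <= 3 / 2 * (16 * lambda) `^ lambda / ln x `^ lambda.
  by rewrite divr_ge0 ?mulr_ge0 ?powR_ge0 //; lra.
apply: le_trans (ler_wpM2l K_ge0 (sum_prime_pow_fact_le j z (ltW A_gt0) w_ge0)).
rewrite /prime_sum_lt mulr_sumr; apply: ler_sum => q q_pr.
rewrite [leRHS]mulrA; apply: ler_wpM2r.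
  by rewrite divr_ge0 ?exprn_ge0 // addr_ge0 ?sumr_ge0 // ltW.
have -> : 3 / 2 * (16 * lambda) `^ lambda / ln x `^ lambda * local_weight A g q
  = ((16 * lambda) `^ lambda / ln x `^ lambda) * (3 / 2 * local_weight A g q).
  by ring.
apply: ler_pM; rewrite ?decay_ge0 ?decay_le //.
  apply: sumr_ge0 => v _.
  by rewrite (twist_ge0 _ gG) // expn_gt0 prime_gt0.
have th_ge0 := ltW (rankin_exponent_gt0 R q_pr).
have th_le : rankin_exponent R q * ln q%:R <= 4^-1.
  by rewrite rankin_exponent_ln.
apply: le_trans (sum_twist_local_le N A_gt0 gG q_pr th_ge0 th_le) _.
rewrite /local_weight mulrDr; apply: lerD.
  apply: ler_wpM2r; first by rewrite g_ge0 // prime_gt0.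
  by apply: le_trans (powR_prime_le q_pr th_ge0 th_le) _; lra.
rewrite -[leLHS]mul1r; apply: ler_wpM2r; last by lra.
by rewrite divr_ge0 // mulr_ge0 // ltW.
Qed.

(** For omega r = j + 1 the local sum at q is O(A / q); together with the factor
    log q / log x of [decay_le_ln] its sum over q is bounded, and only the power
    j remains. *)
Lemma sum_large_part_le_pow_pred (R : realType) (A x lambda : R) (s : nat)
    (g : nat -> R) (N j n : nat) :
  0 < A -> scrG A g -> 1 < x -> 0 < lambda -> (0 < s)%N ->
  (0 < n)%N -> n%:R <= x ->
  \sum_(1 <= r < N.+1 | stratum j.+1 n.+1 r) large_part x lambda s g r
  <= 12 * A * (16 * (lambda + 1)) `^ (lambda + 1) / ln x `^ lambda
     * ((A + prime_sum_lt (local_weight A g) n.+1) ^+ j / j`!%:R).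
Proof.
move=> A_gt0 gG x_gt1 l_gt0 s_gt0 n_gt0 n_le.
apply: le_trans (sum_large_part_le _ _ _ A_gt0 gG x_gt1 l_gt0 s_gt0) _.
have w_ge0 p : prime p -> 0 <= local_weight A g p.
  by move=> p_pr; exact: local_weight_ge0.
have lnx_gt0 : 0 < ln x by rewrite ln_gt0.
set V := A + _; set K := (16 * (lambda + 1)) `^ (lambda + 1).
have V_ge0 : 0 <= V by rewrite addr_ge0 ?prime_sum_lt_ge0 // ltW.
have KL_ge0 : 0 <= K / ln x `^ lambda by rewrite divr_ge0 ?powR_ge0.
have Vj_ge0 : 0 <= V ^+ j / j`!%:R by rewrite divr_ge0 ?exprn_ge0.
apply: (@le_trans _ _ (K / ln x `^ lambda * (V ^+ j / j`!%:R) * (6 * A / ln x)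
    * prime_sum_lt (fun q => ln q%:R / q%:R) n.+1)).
  rewrite ![prime_sum_lt _ n.+1]/prime_sum_lt mulr_sumr.
  rewrite big_nat_cond [leRHS]big_nat_cond.
  apply: ler_sum => q /andP[/andP[_ q_le] q_pr].
  have th_ge0 := ltW (rankin_exponent_gt0 R q_pr).
  have th_le : rankin_exponent R q * ln q%:R <= 4^-1.
    by rewrite rankin_exponent_ln.
  have q_gt0 : 0 < q%:R :> R by rewrite ltr0n prime_gt0.
  have Vq_ge0 : 0 <= A + prime_sum_lt (local_weight A g) q.
    by apply: addr_ge0; [exact: ltW | exact: prime_sum_lt_ge0].
  have Vq_le : A + prime_sum_lt (local_weight A g) q <= V.
    rewrite lerD2l /prime_sum_lt.
    rewrite [leRHS](big_cat_nat _ (n := q)) //=; last first.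
      exact: ltnW.
    by rewrite lerDl sumr_ge0.
  have -> : K / ln x `^ lambda * (V ^+ j / j`!%:R) * (6 * A / ln x)
      * (ln q%:R / q%:R)
    = K / ln x `^ lambda * (ln q%:R / ln x) * (6 * A / q%:R)
      * (V ^+ j / j`!%:R).
    by field; rewrite !gt_eqF ?powR_gt0 // ltr0n fact_gt0.
  have S_ge0 :
      0 <= \sum_(1 <= v < N.+1) twist g (rankin_exponent R q) (q ^ v)%N.
    apply: sumr_ge0 => v _.
    by rewrite (twist_ge0 _ gG) // expn_gt0 prime_gt0.
  apply: ler_pM.
  - by rewrite mulr_ge0 ?decay_ge0.
  - by rewrite divr_ge0 ?exprn_ge0.
  - apply: ler_pM; rewrite ?decay_ge0 ?decay_le_ln //.
    apply: le_trans
      (sum_twist_prime_pow_le _ A_gt0 gG q_pr th_ge0 th_le (ltn0Sn 0)) _.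
    rewrite le_eqVlt; apply/orP; left; apply/eqP.
    by field; rewrite gt_eqF.
  - by apply: ler_wpM2r; rewrite ?invr_ge0 // lerXn2r.
have sum_le : prime_sum_lt (fun p => ln p%:R / p%:R) n.+1 <= 2 * ln x.
  apply: le_trans (sum_ln_prime_div_le _ n_gt0) _.
  by rewrite ler_pM2l // ler_ln ?posrE ?ltr0n //; lra.
apply: le_trans (ler_wpM2l _ sum_le) _.
  apply: mulr_ge0; first exact: mulr_ge0.
  by rewrite divr_ge0 ?mulr_ge0 // ltW.
rewrite le_eqVlt; apply/orP; left; apply/eqP.
by field; rewrite !gt_eqF ?powR_gt0 // ltr0n fact_gt0.
Qed.

(** * Counting by the fibration over n / (s q) *)

Lemma ncard_sum (R : pzSemiRingType) (X : set nat) (N : nat) :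
  (forall n, X n -> (n < N)%N) ->
  (ncard X)%:R = \sum_(0 <= n < N | `[< X n >]) 1 :> R.
Proof.
move=> X_lt; rewrite big_const_seq iter_addr_0 -size_filter; congr (1 *+ _).
have X_fin : finite_set X.
  by apply: (sub_finite_set (B := `I_N)) => // n; exact: X_lt.
apply: perm_size; apply: uniq_perm.
- exact: fset_uniq.
- by rewrite filter_uniq ?iota_uniq.
move=> n; rewrite mem_filter mem_index_iota /= in_fset_set //.
apply/idP/idP => [|/andP[]] /[1!inE] //= Xn.
by rewrite X_lt ?andbT //; apply/asboolP.
Qed.

Lemma omega_mul_prime (q r : nat) : prime q -> (0 < r)%N ->
  omega (q * r) = (~~ (q %| r) + omega r)%N.
Proof.
move=> q_pr r_gt0; rewrite /omega.
have q_in : (q \in primes r) = (q %| r)%N by rewrite mem_primes q_pr r_gt0.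
have mem_qr p : (p \in primes (q * r)) = (p == q) || (p \in primes r).
  by rewrite primesM ?(prime_gt0 q_pr) // primes_prime // inE.
case: (boolP (q %| r)%N) => qr /=; rewrite ?add1n.
  apply: perm_size; apply: uniq_perm; rewrite ?primes_uniq // => p.
  by rewrite mem_qr; case: eqP => // ->; rewrite q_in qr.
apply: (@perm_size _ (primes (q * r)) (q :: primes r)).
by apply: uniq_perm; rewrite /= ?primes_uniq ?q_in ?qr.
Qed.

(** What the fibration knows about r: if m = q r and q is the largest prime
    factor of m, then p r s <= m s <= x for every prime p dividing r. *)
Definition admissible (R : realType) (x : R) (s r : nat) : bool :=
  ((r * s)%:R <= x) && all (fun p => (p * r * s)%:R <= x) (primes r).

Definition last_primes (R : realType) (S : set nat) (x : R) (s r : nat) :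
    set nat :=
  [set q : nat | [/\ prime q, q%:R <= x / (r * s)%:R & S (q * r * s)%N]].

(** The fibration n = q r s, where q is the largest prime factor of n / s. In
    the first sum q does not divide r, so omega r is one less than
    omega (n / s). In the second q divides r; it is then the largest prime
    factor of r, and the fibre has at most one element. *)
Lemma ncard_le_sum_fibres (R : realType) (S : set nat) (x : R) (s j N : nat) :
  (forall n, S n -> (0 < n)%N) -> (0 < s)%N -> (forall n, S n -> (s %| n)%N) ->
  (forall n : nat, n%:R <= x -> (n < N.+1)%N) ->
  (ncard [set n : nat | [/\ S n, n%:R <= x & omega (n %/ s)%N = j.+1]])%:R
  <= \sum_(1 <= r < N.+1 | (omega r == j) && admissible x s r)
        (ncard (last_primes S x s r))%:R
   + \sum_(1 <= r < N.+1 | (omega r == j.+1) && admissible x s r)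
        Num.min 1 (ncard (last_primes S x s r))%:R :> R.
Proof.
move=> S_gt0 s_gt0 S_dvd N_gt.
set X := [set n | _].
pose Z q r := [&& prime q, `[< X (q * r * s)%N >] & max_pdiv (q * r) == q].
have ZP q r : (0 < r)%N -> Z q r ->
    [/\ prime q, last_primes S x s r q, admissible x s r
      & omega r = if (q %| r)%N then j.+1 else j]
    /\ ((q %| r)%N -> q = max_pdiv r).
  move=> r_gt0 /and3P[q_pr /asboolP[Sn n_le n_om] /eqP q_max].
  have qr_gt0 : (0 < q * r)%N by rewrite muln_gt0 prime_gt0.
  have p_le p : p \in primes r -> (p <= q)%N.
    move=> p_in; rewrite -q_max max_pdiv_max //=.
    by rewrite /pi_of inE /= primesM ?p_in ?orbT // prime_gt0.
  split; last first.
    move=> qr; apply/eqP; rewrite eqn_leq max_pdiv_max /=; last first.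
      by rewrite /pi_of inE /= mem_primes q_pr r_gt0.
    apply: p_le; rewrite mem_primes max_pdiv_dvd r_gt0 andbT max_pdiv_prime //.
    exact: leq_trans (prime_gt1 q_pr) (dvdn_leq r_gt0 qr).
  split=> //.
  - split=> //; rewrite ler_pdivlMr ?ltr0n ?muln_gt0 ?r_gt0 //.
    by rewrite -natrM mulnA.
  - apply/andP; split.
      apply: le_trans n_le; rewrite ler_nat -mulnA leq_pmull //.
      exact: prime_gt0.
    apply/allP => p /p_le pq; apply: le_trans n_le.
    by rewrite ler_nat !leq_mul.
  - move: n_om; rewrite mulnK // omega_mul_prime //.
    by case: ifP => _ //= [].
have Y_lt r q : (0 < r)%N -> last_primes S x s r q -> (q < N.+1)%N.
  move=> r_gt0 [q_pr q_le _]; apply: N_gt.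
  have rs_gt0 : (0 < r * s)%N by rewrite muln_gt0 r_gt0.
  move: q_le; rewrite ler_pdivlMr ?ltr0n // -natrM; apply: le_trans.
  by rewrite ler_nat leq_pmulr.
have X_lt n : X n -> (n < N.+1)%N by case=> _ /N_gt.
rewrite (ncard_sum _ X_lt).
apply: (@le_trans _ _ (\sum_(1 <= r < N.+1) \sum_(0 <= q < N.+1 | Z q r) 1)).
  apply: (@le_trans _ _ (\sum_(0 <= n < N.+1 | `[< X n >]) \sum_(1 <= r < N.+1)
      \sum_(0 <= q < N.+1 | Z q r) if n == (q * r * s)%N then 1 else 0)).
    rewrite big_nat_cond [leRHS]big_nat_cond.
    apply: ler_sum => n /andP[/andP[_ n_lt] /asboolP Xn].
    have [Sn n_le n_om] := Xn.
    have n_gt0 := S_gt0 _ Sn; have sn := S_dvd _ Sn.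
    set m := (n %/ s)%N.
    have n_eq : n = (m * s)%N by rewrite divnK.
    have m_gt0 : (0 < m)%N by rewrite divn_gt0 // dvdn_leq.
    have m_gt1 : (1 < m)%N.
      rewrite ltn_neqAle m_gt0 andbT; apply/eqP => m1.
      by move: n_om; rewrite -/m -m1.
    set q := max_pdiv m; set r := (m %/ q)%N.
    have q_pr : prime q by exact: max_pdiv_prime.
    have m_eq : (q * r = m)%N by rewrite mulnC divnK // max_pdiv_dvd.
    have r_gt0 : (0 < r)%N by move: m_gt0; rewrite -m_eq muln_gt0 => /andP[].
    have q_gt0 := prime_gt0 q_pr.
    have r_lt : (r < N.+1)%N.
      apply: leq_ltn_trans n_lt; rewrite n_eq -m_eq mulnAC leq_pmull //.
      by rewrite muln_gt0 q_gt0.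
    have q_lt : (q < N.+1)%N.
      apply: leq_ltn_trans n_lt; rewrite n_eq -m_eq -mulnA leq_pmulr //.
      by rewrite muln_gt0 r_gt0.
    have Zqr : Z q r.
      by rewrite /Z q_pr m_eq -n_eq eqxx andbT; apply/asboolP.
    have term_ge0 r' q' : 0 <= (if n == (q' * r' * s)%N then 1 else 0) :> R.
      by case: ifP.
    apply: le_trans (le_sum_term (i := r) _ _ _) => //; last 2 first.
    - by rewrite mem_index_iota r_gt0.
    - by move=> r' _ _; apply: sumr_ge0.
    apply: le_trans (le_sum_term (i := q) _ _ _) => //.
    - by rewrite m_eq -n_eq eqxx.
    - by rewrite mem_index_iota.
  rewrite exchange_big /=; apply: ler_sum => r _.
  rewrite exchange_big /=; apply: ler_sum => q _.
  by apply: sum_delta_le; rewrite ?iota_uniq.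
rewrite [in leRHS]big_mkcond [X in _ <= _ + X]big_mkcond -big_split /=.
rewrite big_nat_cond [leRHS]big_nat_cond.
apply: ler_sum => r /andP[/andP[r_gt0 _] _].
have le_ncard : \sum_(0 <= q < N.+1 | Z q r) 1
    <= (ncard (last_primes S x s r))%:R :> R.
  rewrite (@ncard_sum _ _ N.+1) => [|q]; last exact: Y_lt.
  rewrite big_mkcond [leRHS]big_mkcond; apply: ler_sum => q _.
  case: ifP => [/(ZP _ _ r_gt0)[[_ Yq _ _] _]|_]; last by case: ifP.
  by rewrite (asboolT Yq).
have rhs_ge0 : 0 <= (if (omega r == j) && admissible x s r then
      (ncard (last_primes S x s r))%:R else 0)
    + (if (omega r == j.+1) && admissible x s r then
      Num.min 1 (ncard (last_primes S x s r))%:R else 0) :> R.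
  by apply: addr_ge0; case: ifP => // _; rewrite le_min ler01 ler0n.
have [/hasP[q0 _ Zq0]|/hasPn noZ] := boolP (has (Z^~ r) (index_iota 0 N.+1));
    last first.
  by rewrite big_seq_cond big1 // => q /andP[/noZ/negbTE->].
have [[_ _ r_adm r_om] _] := ZP _ _ r_gt0 Zq0.
rewrite r_adm !andbT.
move: r_om; case: ifP => q0r r_om; rewrite r_om; last first.
  by rewrite eqxx ltn_eqF // addr0.
rewrite gtn_eqF // eqxx add0r le_min le_ncard andbT.
(* All q in the fibre divide r, hence equal its largest prime factor. *)
apply: le_trans (@sum_delta_le R _ (index_iota 0 N.+1) (Z^~ r) (max_pdiv r) 1
  (iota_uniq _ _) ler01).
apply: ler_sum => q Zq; have [[_ _ _ om_q] q_eq] := ZP _ _ r_gt0 Zq.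
rewrite -q_eq ?eqxx //; move: om_q; rewrite r_om.
by case: ifP => // _ /eqP; rewrite gtn_eqF.
Qed.

(** * The two ranges of r and the final bound *)

(** The local sums of 1 / p^(2 v) are at most 4 / (3 p^2). One of the j + 1
    factors 4/3 is set aside, to leave the power j of the final bound. *)
Lemma sum_inv_sqr_stratum_le (R : realType) (N j z : nat) :
  \sum_(1 <= r < N.+1 | stratum j.+1 z r) (r%:R ^+ 2)^-1
  <= 4 / 3 * ((4 / 3) ^+ j / j`!%:R) :> R.
Proof.
pose h (n : nat) : R := (n%:R ^+ 2)^-1.
have h_ge0 n : 0 <= h n by rewrite invr_ge0 exprn_ge0.
apply: le_trans (@sum_stratum_le R h N j.+1 z _ _ _) _ => //.
- by rewrite /h expr1n invr1.
- by move=> q v r _ _ _ _; rewrite /h natrM exprMn invfM.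
have sum_ge0 : 0 <= prime_sum_lt (fun p => \sum_(1 <= v < N.+1) h (p ^ v)%N) z.
  by apply: prime_sum_lt_ge0 => p _; apply: sumr_ge0.
have sum_le :
    prime_sum_lt (fun p => \sum_(1 <= v < N.+1) h (p ^ v)%N) z <= 4 / 3.
  have c_ge0 : 0 <= 4 / 3 :> R by lra.
  rewrite -[leRHS]mulr1.
  apply: le_trans (ler_wpM2l c_ge0 (sum_inv_prime_sqr_le R z)).
  rewrite /prime_sum_lt mulr_sumr; apply: ler_sum => p p_pr.
  have p_ge2 : 2 <= p%:R :> R by rewrite ler_nat prime_gt1.
  have p2_ge4 : 4 <= p%:R ^+ 2 :> R by rewrite expr2; nra.
  have t_le : (p%:R ^+ 2)^-1 <= 4^-1 :> R by rewrite lef_pV2 ?posrE //; lra.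
  set t : R := (p%:R ^+ 2)^-1 in t_le *.
  have t_ge0 : 0 <= t by rewrite invr_ge0; lra.
  have -> : \sum_(1 <= v < N.+1) h (p ^ v)%N = \sum_(1 <= v < N.+1) t ^+ v.
    by apply: eq_bigr => v _; rewrite /h /t natrX exprAC exprVn.
  have t_lt1 : t < 1 by lra.
  apply: le_trans (sum_geometric_le 1 N.+1 t_ge0 t_lt1) _.
  by rewrite expr1 ler_pdivrMr; nra.
have pow_le := lerXn2r j.+1 _ _ sum_le.
apply: (@le_trans _ _ ((4 / 3) ^+ j.+1 / j.+1`!%:R)).
  by apply: ler_wpM2r; rewrite ?invr_ge0 // pow_le // nnegrE; lra.
rewrite exprS mulrA; apply: ler_wpM2l.
  by rewrite mulr_ge0 ?exprn_ge0; lra.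
by rewrite lef_pV2 ?posrE ?ltr0n ?fact_gt0 // ler_nat factS leq_pmull.
Qed.

(** This is where the lower bound on B enters. Since
    sqrt L <= L / 4 + 1 for L = log x, there remains a factor exp (L / 4), which
    absorbs L^lambda. *)
Lemma sqrt_le_main_term (R : realType) (x B lambda : R) :
  1 < x -> 0 < lambda -> expR (- Num.sqrt (ln x)) <= B ->
  x `^ 2^-1 <= expR 1 * (4 * lambda) `^ lambda * (B * x / ln x `^ lambda).
Proof.
move=> x_gt1 l_gt0 B_ge.
have L_gt0 : 0 < ln x by rewrite ln_gt0.
have x_gt0 : 0 < x by lra.
set L := ln x in L_gt0 B_ge *.
(* The difference of the two sides is (sqrt L / 2 - 1)^2. *)
have sqrt_le : Num.sqrt L <= L / 4 + 1.
  have := sqr_sqrtr (ltW L_gt0); have := sqrtr_ge0 L.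
  move: (Num.sqrt L) => y y_ge0 y2; rewrite -y2.
  have := sqr_ge0 (y / 2 - 1); lra.
have pow_le : L `^ lambda * expR (- (4^-1 * L)) <= (4 * lambda) `^ lambda.
  have c_gt0 : 0 < 4^-1 :> R by rewrite invr_gt0.
  have := powR_expR_bounded l_gt0 c_gt0 L_gt0.
  by rewrite invrK [lambda * 4]mulrC.
rewrite mulrA ler_pdivlMr ?powR_gt0 //.
have -> : x `^ 2^-1 = expR (L / 2) by rewrite /powR gt_eqF // mulrC.
have x_exp : x = expR L by rewrite lnK.
apply: (@le_trans _ _ (expR 1 * (L `^ lambda * expR (- (4^-1 * L)))
    * (expR (- Num.sqrt L) * x))); last first.
  apply: ler_pM; rewrite ?mulr_ge0 ?powR_ge0 ?expR_ge0 ?(ltW x_gt0) //.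
    by apply: ler_wpM2l; rewrite ?expR_ge0.
  by apply: ler_wpM2r; rewrite ?(ltW x_gt0).
have -> : expR 1 * (L `^ lambda * expR (- (4^-1 * L)))
    * (expR (- Num.sqrt L) * x)
  = expR (1 + (- (4^-1 * L) + (- Num.sqrt L + L))) * L `^ lambda.
  by rewrite !expRD [in LHS]x_exp; ring.
apply: ler_wpM2r; first exact: powR_ge0.
by rewrite ler_expR; lra.
Qed.

(** For r <= x^(1/4) the bound s <= x^(1/2) gives x / (r s) >= x^(1/4). *)
Lemma fibre_weight_le (R : realType) (A x lambda : R) (g : nat -> R)
    (s r : nat) :
  scrG A g -> 1 < x -> 0 < lambda -> (0 < s)%N -> s%:R ^+ 2 <= x ->
  (0 < r)%N -> admissible x s r ->
  g r / ln (2 * x / (r * s)%:R) `^ lambda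
  <= 4 `^ lambda / ln x `^ lambda * g r + large_part x lambda s g r.
Proof.
move=> gG x_gt1 l_gt0 s_gt0 s_le r_gt0 /andP[rs_le r_adm].
have [_ g_ge0 _] := gG; have gr_ge0 := g_ge0 _ r_gt0.
have L_gt0 : 0 < ln x by rewrite ln_gt0.
have x_gt0 : 0 < x by lra.
have first_ge0 : 0 <= 4 `^ lambda / ln x `^ lambda * g r.
  by rewrite mulr_ge0 ?divr_ge0 ?powR_ge0.
rewrite /large_part; case: ltP => [r_gt|r_le] /=.
  by rewrite r_adm lerDr.
rewrite addr0 mulrC; apply: ler_wpM2r => //.
have s_gt0R : 0 < s%:R :> R by rewrite ltr0n.
have r_gt0R : 0 < r%:R :> R by rewrite ltr0n.
have lns : 2 * ln s%:R <= ln x.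
  by rewrite mulr_natl -lnXn // ler_ln ?posrE ?exprn_gt0.
have lnr : ln r%:R <= 4^-1 * ln x.
  by rewrite -ln_powR ler_ln ?posrE ?powR_gt0.
have ln_ge : ln x / 4 <= ln (2 * x / (r * s)%:R).
  rewrite natrM ln_div ?posrE ?mulr_gt0 // !lnM ?posrE //.
  have : 0 <= ln 2 :> R by rewrite ln_ge0 // ler1n.
  lra.
have L4_gt0 : 0 < ln x / 4 by rewrite divr_gt0.
have -> : 4 `^ lambda / ln x `^ lambda = ((ln x / 4) `^ lambda)^-1.
  have -> : ln x `^ lambda = (ln x / 4) `^ lambda * 4 `^ lambda.
    by rewrite -powRM ?(ltW L4_gt0) // divfK.
  by field; rewrite !gt_eqF ?powR_gt0.
rewrite lef_pV2 ?posrE ?powR_gt0 //; last exact: lt_le_trans ln_ge.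
apply: ge0_ler_powR; rewrite ?nnegrE ?(ltW l_gt0) ?(ltW L4_gt0) //.
exact: ltW (lt_le_trans _ ln_ge).
Qed.

Lemma one_le_rankin_square (R : realType) (x : R) (r : nat) : 0 < x ->
  (0 < r)%N -> r%:R <= x `^ 4^-1 -> 1 <= x `^ 2^-1 * (r%:R ^+ 2)^-1.
Proof.
move=> x_gt0 r_gt0 r_le.
rewrite ler_pdivlMr ?exprn_gt0 ?ltr0n // mul1r.
have -> : 2^-1 = 4^-1 * 2 :> R by lra.
rewrite powRrM powR_mulrn ?powR_ge0 //.
by rewrite lerXn2r // nnegrE ?powR_ge0.
Qed.

(** For j = 0 the sum is empty: its only candidate is r = 1, which is not larger
    than x^(1/4). *)
Lemma sum_large_part_le_pow (R : realType) (A x lambda : R) (s : nat)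
    (g : nat -> R) (N j z : nat) :
  0 < A -> scrG A g -> 1 < x -> 0 < lambda -> (0 < s)%N ->
  \sum_(1 <= r < N.+1 | stratum j z r) large_part x lambda s g r
  <= 3 / 2 * (16 * lambda) `^ lambda / ln x `^ lambda
     * ((A + prime_sum_lt (local_weight A g) z) ^+ j / j`!%:R).
Proof.
move=> A_gt0 gG x_gt1 l_gt0 s_gt0; case: j => [|j]; last first.
  exact: sum_large_part_le_powS.
rewrite big_nat_cond big1 => [|r /andP[/andP[r_gt0 _] /andP[r_om _]]].
  rewrite expr0 fact0 divr1 mulr1 divr_ge0 ?mulr_ge0 ?powR_ge0 //; lra.
move: r_om; rewrite omega_eq0 // => /eqP ->.
rewrite /large_part ltNge.
have -> // : 1%:R <= x `^ 4^-1.
by rewrite -[leLHS](powRr0 x) ler_powR // ?invr_ge0 // ltW.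
Qed.

Lemma stratum_full (N j r : nat) : (0 < r < N.+1)%N ->
  stratum j N.+1 r = (omega r == j).
Proof.
move=> /andP[r_gt0 r_lt]; rewrite /stratum.
have -> : friable N.+1 r; last by rewrite andbT.
apply/allP => p; rewrite mem_primes => /and3P[_ _ pr].
exact: leq_ltn_trans (dvdn_leq r_gt0 pr) r_lt.
Qed.

Theorem theorem1 (R : realType) (A : R) (A_gt0 : 0 < A) :
  exists2 C : R, 0 < C &
  forall lambda : R, 0 < lambda ->
  exists2 K : R, 0 < K &
  forall (S : set nat) (s : nat) (g : nat -> R) (x B : R),
    (forall n : nat, S n -> (0 < n)%N) ->
    (0 < s)%N ->
    (forall n : nat, S n -> (s %| n)%N) ->
    scrG A g ->
    1 < x ->
    s%:R ^+ 2 <= x ->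
    expR (- Num.sqrt (ln x)) <= B ->
    (forall r : nat, (1 <= r)%N -> r%:R <= x / s%:R ->
      (ncard [set q : nat | [/\ prime q, q%:R <= x / (r * s)%:R &
                                S (q * r * s)%N]])%:R
      <= B * x * (g r / (ln (2 * x / (r * s)%:R)) `^ lambda)) ->
    forall k : nat, (0 < k)%N ->
      (ncard [set n : nat | [/\ S n, n%:R <= x & omega (n %/ s)%N = k]])%:R
      <= K * B * x * ((prime_sum g x + C) ^+ k.-1
                      / ((k.-1)`!%:R * (ln x) `^ lambda)).
Proof.
(* 9 A bounds the prime powers, A the twist; 4/3 comes from the count of the
   r <= x^(1/4). *)
exists (10 * A + 4 / 3); first by lra.
move=> lambda l_gt0.
pose K1 := 3 / 2 * (16 * lambda) `^ lambda.
pose K2 := 12 * A * (16 * (lambda + 1)) `^ (lambda + 1).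
pose K3 := expR 1 * (4 * lambda) `^ lambda.
have K1_ge0 : 0 <= K1 by rewrite mulr_ge0 ?powR_ge0 //; lra.
have K2_ge0 : 0 <= K2 by rewrite mulr_ge0 ?powR_ge0 //; lra.
have K3_ge0 : 0 <= K3 by rewrite mulr_ge0 ?powR_ge0 ?expR_ge0.
exists (4 `^ lambda + K1 + K2 + K3 * (4 / 3)).
  have : 0 < 4 `^ lambda :> R by rewrite powR_gt0.
  lra.
move=> S s g x B S_gt0 s_gt0 S_dvd gG x_gt1 s_le B_ge fibre_le [//|j] _.
rewrite -pred_Sn.
have [_ g_ge0 _] := gG.
have x_gt0 : 0 < x by lra.
have L_gt0 : 0 < ln x by rewrite ln_gt0.
have Ll_gt0 : 0 < ln x `^ lambda by rewrite powR_gt0.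
have B_gt0 : 0 < B by apply: lt_le_trans B_ge; exact: expR_gt0.
have Bx_gt0 : 0 < B * x by rewrite mulr_gt0.
have s_gt0R : 0 < s%:R :> R by rewrite ltr0n.
set N := Num.truncn x.
have N_le : N%:R <= x by rewrite truncn_le // ltW.
have N_gt n : n%:R <= x -> (n < N.+1)%N.
  by move=> n_le; rewrite ltnS /N truncn_ge_nat // ltW.
have N_gt0 : (0 < N)%N by rewrite -ltnS N_gt // ltW.
set C := 10 * A + 4 / 3.
have G_eq : prime_sum g x = prime_sum_lt g N.+1 by [].
have G_ge0 : 0 <= prime_sum_lt g N.+1.
  by apply: prime_sum_lt_ge0 => p p_pr; rewrite g_ge0 // prime_gt0.
rewrite G_eq; set P := (prime_sum_lt g N.+1 + C) ^+ j / j`!%:R.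
have P_ge0 : 0 <= P by rewrite divr_ge0 ?exprn_ge0 // addr_ge0 // /C; lra.
have W_ge0 : 0 <= prime_sum_lt (local_weight A g) N.+1.
  by apply: prime_sum_lt_ge0 => p p_pr; exact: local_weight_ge0.
have W_le := prime_sum_lt_weight_le g N.+1 A_gt0.
have to_P y : 0 <= y -> y <= prime_sum_lt g N.+1 + C -> y ^+ j / j`!%:R <= P.
  move=> y_ge0 y_le; apply: ler_wpM2r; first by rewrite invr_ge0.
  by rewrite lerXn2r // nnegrE // (le_trans y_ge0).
have VP : (A + prime_sum_lt (local_weight A g) N.+1) ^+ j / j`!%:R <= P.
  apply: to_P; first by rewrite addr_ge0 // ltW.
  by rewrite /C; lra.
have WP : prime_sum_lt (local_weight A g) N.+1 ^+ j / j`!%:R <= P.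
  by apply: to_P => //; rewrite /C; lra.
have DP : (4 / 3) ^+ j / j`!%:R <= P by apply: to_P; rewrite /C; lra.
have fibre r : (0 < r)%N -> admissible x s r ->
    (ncard (last_primes S x s r))%:R
    <= B * x * (4 `^ lambda / ln x `^ lambda * g r + large_part x lambda s g r).
  move=> r_gt0 r_adm; have [rs_le _] := andP r_adm.
  apply: le_trans (fibre_le r r_gt0 _) _.
    by rewrite ler_pdivlMr // -natrM.
  rewrite ler_pM2l ?mulr_gt0 //.
  exact: fibre_weight_le gG _ _ _ _ _ _.
have first_sum : \sum_(1 <= r < N.+1 | (omega r == j) && admissible x s r)
      (ncard (last_primes S x s r))%:R
    <= B * x / ln x `^ lambda * ((4 `^ lambda + K1) * P).
  apply: (@le_trans _ _ (\sum_(1 <= r < N.+1 | stratum j N.+1 r) B * x *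
      (4 `^ lambda / ln x `^ lambda * g r + large_part x lambda s g r))).
    rewrite big_mkcond [leRHS]big_mkcond big_nat_cond [leRHS]big_nat_cond.
    apply: ler_sum => r /andP[r_in _]; rewrite stratum_full //.
    have [r_gt0 _] := andP r_in.
    case: (omega r == j) => //=; case: ifP => r_adm; first exact: fibre.
    apply: mulr_ge0; first exact: ltW.
    apply: addr_ge0; last exact: large_part_ge0 gG _.
    by rewrite mulr_ge0 ?divr_ge0 ?powR_ge0 ?g_ge0.
  have -> : B * x / ln x `^ lambda * ((4 `^ lambda + K1) * P)
    = B * x * (4 `^ lambda / ln x `^ lambda * P + K1 / ln x `^ lambda * P).
    by ring.
  rewrite -mulr_sumr ler_pM2l // big_split /= -mulr_sumr; apply: lerD.
    apply: ler_wpM2l; first by rewrite divr_ge0 ?powR_ge0.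
    exact: le_trans (sum_stratum_scrG_le _ _ _ A_gt0 gG) WP.
  apply: le_trans (sum_large_part_le_pow _ _ _ A_gt0 gG x_gt1 l_gt0 s_gt0) _.
  by apply: ler_wpM2l => //; rewrite divr_ge0 ?powR_ge0.
(* The r <= x^(1/4) are counted trivially, the others through the hypothesis. *)
have second_sum : \sum_(1 <= r < N.+1 | (omega r == j.+1) && admissible x s r)
      Num.min 1 (ncard (last_primes S x s r))%:R
    <= B * x / ln x `^ lambda * ((K2 + K3 * (4 / 3)) * P).
  apply: (@le_trans _ _ (\sum_(1 <= r < N.+1 | stratum j.+1 N.+1 r)
      (B * x * large_part x lambda s g r + x `^ 2^-1 * (r%:R ^+ 2)^-1))).
    rewrite big_mkcond [leRHS]big_mkcond big_nat_cond [leRHS]big_nat_cond.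
    apply: ler_sum => r /andP[r_in _]; rewrite stratum_full //.
    have [r_gt0 _] := andP r_in.
    have sqr_ge0 : 0 <= x `^ 2^-1 * (r%:R ^+ 2)^-1.
      by rewrite mulr_ge0 ?powR_ge0 ?invr_ge0 ?exprn_ge0.
    have large_ge0 : 0 <= B * x * large_part x lambda s g r.
      by apply: mulr_ge0; [exact: ltW | exact: large_part_ge0 gG _].
    case: (omega r == j.+1) => //=; case: ifP => r_adm; last exact: addr_ge0.
    have [r_le|r_gt] := leP r%:R (x `^ 4^-1).
      apply: (@le_trans _ _ 1); first by rewrite ge_min lexx.
      apply: le_trans (one_le_rankin_square x_gt0 r_gt0 r_le) _.
      by rewrite lerDr.
    apply: (@le_trans _ _ (B * x * large_part x lambda s g r)); last first.
      by rewrite lerDl.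
    rewrite ge_min; apply/orP; right.
    have [rs_le r_all] := andP r_adm.
    apply: le_trans (fibre_le r r_gt0 _) _.
      by rewrite ler_pdivlMr // -natrM.
    by rewrite /large_part r_gt r_all.
  have -> : B * x / ln x `^ lambda * ((K2 + K3 * (4 / 3)) * P)
    = B * x * (K2 / ln x `^ lambda * P)
      + K3 * (B * x / ln x `^ lambda) * (4 / 3 * P) by ring.
  rewrite big_split /= -!mulr_sumr; apply: lerD.
    rewrite ler_pM2l //.
    apply: le_trans (sum_large_part_le_pow_pred N j A_gt0 gG x_gt1 l_gt0 s_gt0
      N_gt0 N_le) _.
    by apply: ler_wpM2l => //; rewrite divr_ge0 ?powR_ge0.
  apply: ler_pM.
  - exact: powR_ge0.
  - by apply: sumr_ge0 => r _; rewrite invr_ge0 exprn_ge0.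
  - exact: sqrt_le_main_term.
  - apply: le_trans (sum_inv_sqr_stratum_le R N j N.+1) _.
    by apply: ler_wpM2l => //; lra.
apply: le_trans (ncard_le_sum_fibres j S_gt0 s_gt0 S_dvd N_gt) _.
apply: le_trans (lerD first_sum second_sum) _.
rewrite le_eqVlt; apply/orP; left; apply/eqP; rewrite /P.
by field; rewrite !gt_eqF // ltr0n fact_gt0.
Qed.
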